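(* Let $\mathcal{M}^m$ be the set of all maxmin copulas. Then every $C\in\mathcal{M}^m$ satisfies $\mu_\infty(C)\le\frac{4}{27}$, and the bound is attained by some maxmin copula, i.e. $\mu_\infty(\mathcal{M}^m):=\sup_{C\in\mathcal{M}^m}\mu_\infty(C)=\frac{4}{27}$. The maximal asymmetry function $d^*_{\mathcal{M}^m}(x,y)=\sup_{C\in\mathcal{M}^m}|C(x,y)-C(y,x)|$ is given for $x,y\in[0,1]$ by $$d^*_{\mathcal{M}^m}(x,y)=\begin{cases}\frac{x}{y}(y-x); & \text{if } \max\{1-y,y^2\}\le x\le y,\\ \frac{1-y}{1-x}(y-x); & \text{if } x\le y\le\min\{2x-x^2,1-x\},\\ x(1-y); & \text{if } y\ge\min\{\sqrt{x},2x-x^2\},\\ y(1-x); & \text{if } x\ge\min\{\sqrt{y},2y-y^2\},\\ \frac{y}{x}(x-y); & \text{if } \max\{1-x,x^2\}\le y\le x,\\ \frac{1-x}{1-y}(x-y); & \text{if } y\le x\le\min\{2y-y^2,1-y\}.\end{cases}$$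
   Context: A (bivariate) copula is a function $C:[0,1]^2\to[0,1]$ such that $C(x,0)=0=C(0,y)$, $C(x,1)=x$, $C(1,y)=y$ for all $x,y\in[0,1]$, and $C(x_2,y_2)-C(x_2,y_1)-C(x_1,y_2)+C(x_1,y_1)\ge 0$ whenever $0\le x_1\le x_2\le1$ and $0\le y_1\le y_2\le 1$. For a copula $C$, $\mu_\infty(C)=\max_{x,y\in[0,1]}|C(x,y)-C(y,x)|$. A maxmin copula is a copula of the form $C(x,y)=\min\{x,\ \phi(x)y-\phi(x)\psi(y)+x\psi(y)\}$, where $\phi,\psi:[0,1]\to[0,1]$ are nondecreasing functions with $\phi(0)=\psi(0)=0$, $\phi(1)=\psi(1)=1$, such that $\phi^*(x)=\frac{\phi(x)}{x}$ (on $(0,1]$) and $\psi_*(x)=\frac{1-\psi(x)}{x-\psi(x)}$ are nonincreasing, where $\psi_*(x)=\infty$ if $\psi(x)=x$ and $x<1$, and $\psi_*(1)=1$. Equivalently (a known fact), setting $f(x)=\phi(x)-x$ and $g(x)=1-x-\psi(1-x)$, a maxmin copula is $C(x,y)=\min\{x,\ xy+f(x)g(1-y)\}$ where $f,g$ belong to the set $\mathcal{F}$ of functions $h:[0,1]\to[0,1]$ with $h(0)=h(1)=0$, $h(x)+x$ nondecreasing on $[0,1]$, and $h(x)/x$ nonincreasing on $(0,1]$. In the piecewise formula, overlapping cases give the same value. *)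

(* Defs.v *)
From HB Require Import structures.
From mathcomp Require Import all_boot all_order all_algebra.
From mathcomp Require Import all_classical all_reals all_analysis.
From mathcomp Require Import ring lra.

Set Implicit Arguments.
Unset Strict Implicit.
Unset Printing Implicit Defensive.

Import Order.TTheory GRing.Theory Num.Theory.
Import numFieldNormedType.Exports.

Local Open Scope classical_set_scope.
Local Open Scope ring_scope.

(* A function [0,1] -> [0,1] (or [0,1]^2 -> [0,1]) is represented by a total
   function on R; every condition, and every later use, only involves its
   values on [0,1] (or [0,1]^2), so the values elsewhere are irrelevant. *)

Definition copula (R : realType) (C : R -> R -> R) : Prop :=
  [/\ forall x y, 0 <= x <= 1 -> 0 <= y <= 1 -> 0 <= C x y <= 1,
      forall x, 0 <= x <= 1 -> C x 0 = 0 /\ C 0 x = 0,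
      forall x, 0 <= x <= 1 -> C x 1 = x /\ C 1 x = x &
      forall x1 x2 y1 y2, 0 <= x1 -> x1 <= x2 -> x2 <= 1 ->
        0 <= y1 -> y1 <= y2 -> y2 <= 1 ->
        0 <= C x2 y2 - C x2 y1 - C x1 y2 + C x1 y1].

Definition phi_star (R : realType) (phi : R -> R) (x : R) : R := phi x / x.

Definition psi_star (R : realType) (psi : R -> R) (x : R) : \bar R :=
  if x == 1 then 1%:E
  else if psi x == x then +oo%E
  else ((1 - psi x) / (x - psi x))%:E.

Definition generator (R : realType) (h : R -> R) : Prop :=
  [/\ forall x, 0 <= x <= 1 -> 0 <= h x <= 1,
      forall x1 x2, 0 <= x1 -> x1 <= x2 -> x2 <= 1 -> h x1 <= h x2,
      h 0 = 0 & h 1 = 1].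

Definition maxmin_generators (R : realType) (phi psi : R -> R) : Prop :=
  [/\ generator phi, generator psi,
      forall x1 x2, 0 < x1 -> x1 <= x2 -> x2 <= 1 ->
        phi_star phi x2 <= phi_star phi x1 &
      forall x1 x2, 0 <= x1 -> x1 <= x2 -> x2 <= 1 ->
        (psi_star psi x2 <= psi_star psi x1)%E].

Definition maxmin_copula (R : realType) : set (R -> R -> R) :=
  [set C | copula C /\
    exists phi psi : R -> R, maxmin_generators phi psi /\
      forall x y, 0 <= x <= 1 -> 0 <= y <= 1 ->
        C x y = Num.min x (phi x * y - phi x * psi y + x * psi y)].

(* For a copula this supremum is a maximum, see mu_infty_max below. *)
Definition mu_infty (R : realType) (C : R -> R -> R) : R :=
  sup [set d | exists x y, [/\ 0 <= x <= 1, 0 <= y <= 1 &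
                               d = `|C x y - C y x|]].

Definition max_asymmetry (R : realType) (x y : R) : R :=
  sup [set `|C x y - C y x| | C in @maxmin_copula R].

(* The remaining facts show that the real-valued suprema above are not taken
   over empty or unbounded sets (where sup is 0 by convention). *)

Section well_defined.
Variable R : realType.
Implicit Types (C : R -> R -> R) (x y : R).

Lemma copula_lipschitz C : copula C ->
  forall x1 x2 y1 y2, 0 <= x1 <= 1 -> 0 <= x2 <= 1 ->
    0 <= y1 <= 1 -> 0 <= y2 <= 1 ->
  `|C x1 y1 - C x2 y2| <= `|x1 - x2| + `|y1 - y2|.
Proof.
move=> [_ C0 C1 C2] x1 x2 y1 y2 hx1 hx2 hy1 hy2.
have lx a b y : 0 <= a <= 1 -> 0 <= b <= 1 -> 0 <= y <= 1 ->
    `|C a y - C b y| <= `|a - b|.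
  wlog ab : a b / a <= b => [H|] ha hb hy.
    have [/H|/ltW/H] := leP a b; first exact.
    by rewrite distrC (distrC b); exact.
  have := C2 a b 0 y; have := C2 a b y 1.
  have [-> _] := C0 a ha; have [-> _] := C0 b hb.
  have [-> _] := C1 a ha; have [-> _] := C1 b hb.
  move: ha hb hy => /andP[a0 a1] /andP[b0 b1] /andP[y0 y1'].
  move=> /(_ a0 ab b1 y0 y1' (lexx _)) H1.
  move=> /(_ a0 ab b1 (lexx _) y0 y1') H2.
  by rewrite (distrC (C a y)) (distrC a) !ger0_norm; lra.
have ly a b x : 0 <= a <= 1 -> 0 <= b <= 1 -> 0 <= x <= 1 ->
    `|C x a - C x b| <= `|a - b|.
  wlog ab : a b / a <= b => [H|] ha hb hy.
    have [/H|/ltW/H] := leP a b; first exact.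
    by rewrite distrC (distrC b); exact.
  have := C2 0 x a b; have := C2 x 1 a b.
  have [_ ->] := C0 a ha; have [_ ->] := C0 b hb.
  have [_ ->] := C1 a ha; have [_ ->] := C1 b hb.
  move: ha hb hy => /andP[a0 a1] /andP[b0 b1] /andP[y0 y1'].
  move=> /(_ y0 y1' (lexx _) a0 ab b1) H1.
  move=> /(_ (lexx _) y0 y1' a0 ab b1) H2.
  by rewrite (distrC (C x a)) (distrC a) !ger0_norm; lra.
rewrite (le_trans (ler_distD (C x2 y1) _ _))// lerD//.
  exact: lx.
exact: ly.
Qed.

Lemma mu_infty_max C : copula C ->
  exists x y, [/\ 0 <= x <= 1, 0 <= y <= 1, mu_infty C = `|C x y - C y x| &
    forall x' y', 0 <= x' <= 1 -> 0 <= y' <= 1 ->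
      `|C x' y' - C y' x'| <= `|C x y - C y x|].
Proof.
move=> cC; pose A : set (R * R) := `[0, 1] `*` `[0, 1].
pose f (p : R * R) := `|C p.1 p.2 - C p.2 p.1|.
have AE p : A p <-> 0 <= p.1 <= 1 /\ 0 <= p.2 <= 1.
  by rewrite /A/= !in_itv/=.
have A0 : A !=set0 by exists (0, 0); apply/AE; rewrite /= lexx ler01.
have cA : compact A by apply: compact_setX; exact: segment_compact.
have fA : {within A, continuous f}.
  apply/subspace_continuousP => p /AE[p1 p2].
  apply/cvgrPdist_le => e e0; near=> q.
  have /AE[q1 q2] : A q by near: q; exact: withinT.
  have d1 : `|p.1 - q.1| <= e / 4.
    near: q; apply: cvg_within; case: p {p1 p2} => a b /=.
    have fsta : fst @ nbhs (a, b) --> a by exact: cvg_fst.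
    by have /cvgrPdist_le := fsta; apply; lra.
  have d2 : `|p.2 - q.2| <= e / 4.
    near: q; apply: cvg_within; case: p {p1 p2} => a b /=.
    have sndb : snd @ nbhs (a, b) --> b by exact: cvg_snd.
    by have /cvgrPdist_le := sndb; apply; lra.
  have h1 := copula_lipschitz cC p1 q1 p2 q2.
  have h2 := copula_lipschitz cC p2 q2 p1 q1.
  rewrite /f; apply: le_trans (ler_dist_dist _ _) _.
  have -> : C p.1 p.2 - C p.2 p.1 - (C q.1 q.2 - C q.2 q.1) =
    (C p.1 p.2 - C q.1 q.2) - (C p.2 p.1 - C q.2 q.1) by ring.
  apply: le_trans (ler_normB _ _) _; lra.
have [[x y] /set_mem/AE[/= hx hy] max] := compact_EVT_max A0 cA fA.
have {}max x' y' : 0 <= x' <= 1 -> 0 <= y' <= 1 ->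
    `|C x' y' - C y' x'| <= `|C x y - C y x|.
  by move=> h1 h2; apply: (max (x', y')); apply/mem_set/AE.
exists x, y; split => //; apply/eqP; rewrite eq_le; apply/andP; split.
  apply: ge_sup; first by exists (`|C x y - C y x|), x, y.
  by move=> _ [x' [y' [h1 h2 ->]]]; exact: max.
apply: ub_le_sup; last by exists x, y.
by exists (`|C x y - C y x|) => _ [x' [y' [h1 h2 ->]]]; exact: max.
Unshelve. all: by end_near. Qed.

Lemma asymmetry_le1 C : copula C ->
  forall x y, 0 <= x <= 1 -> 0 <= y <= 1 -> `|C x y - C y x| <= 1.
Proof.
move=> [C01 _ _ _] x y hx hy; have := C01 _ _ hx hy; have := C01 _ _ hy hx.
by rewrite ler_norml; lra.
Qed.

Lemma maxmin_copula_prod : @maxmin_copula R (fun x y => x * y).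
Proof.
have gen : generator (@id R) by split.
split.
  split.
  - by move=> x y /andP[? ?] /andP[? ?]; rewrite mulr_ge0// mulr_ile1.
  - by move=> x _; rewrite mulr0 mul0r.
  - by move=> x _; rewrite mulr1 mul1r.
  - move=> x1 x2 y1 y2 _ hx _ _ hy _.
    have -> : x2 * y2 - x2 * y1 - x1 * y2 + x1 * y1 = (x2 - x1) * (y2 - y1).
      by ring.
    by rewrite mulr_ge0// subr_ge0.
exists id, id; split.
  split => //.
  - move=> x1 x2 x10 x12 _; rewrite /phi_star !divff// gt_eqF//.
    exact: lt_le_trans x12.
  - move=> x1 x2 _ x12 x21; rewrite /psi_star eqxx.
    have [x2E|x2N] := eqVneq x2 1; first by case: (x1 == 1); rewrite ?eqxx ?leey.
    by rewrite lt_eqF ?eqxx// (le_lt_trans x12)// lt_neqAle x2N.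
move=> x y /andP[x0 x1] /andP[y0 y1].
have -> : x * y - x * y + x * y = x * y by ring.
by rewrite min_r// ler_piMr.
Qed.

Lemma has_sup_mu_infty : has_sup [set @mu_infty R C | C in @maxmin_copula R].
Proof.
split; first by exists (mu_infty (fun x y => x * y)), (fun x y => x * y) => //;
  exact: maxmin_copula_prod.
exists 1 => _ [C [cC _] <-].
by have [x [y [hx hy -> _]]] := mu_infty_max cC; exact: asymmetry_le1.
Qed.

Lemma has_sup_max_asymmetry x y : 0 <= x <= 1 -> 0 <= y <= 1 ->
  has_sup [set `|C x y - C y x| | C in @maxmin_copula R].
Proof.
move=> hx hy; split.
  by eexists; exists (fun x y => x * y); first exact: maxmin_copula_prod.
by exists 1 => _ [C [cC _] <-]; exact: asymmetry_le1.
Qed.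

(* The cases of the formula for max_asymmetry cover the whole unit square. *)
Lemma cases_cover x y : 0 <= x <= 1 -> 0 <= y <= 1 ->
  [|| Num.max (1 - y) (y ^+ 2) <= x <= y,
      x <= y <= Num.min (2 * x - x ^+ 2) (1 - x),
      Num.min (Num.sqrt x) (2 * x - x ^+ 2) <= y,
      Num.min (Num.sqrt y) (2 * y - y ^+ 2) <= x,
      Num.max (1 - x) (x ^+ 2) <= y <= x |
      y <= x <= Num.min (2 * y - y ^+ 2) (1 - y)].
Proof.
have half (a b : R) : 0 <= a <= 1 -> 0 <= b <= 1 -> a <= b ->
  [|| Num.max (1 - b) (b ^+ 2) <= a <= b,
      a <= b <= Num.min (2 * a - a ^+ 2) (1 - a) |
      Num.min (Num.sqrt a) (2 * a - a ^+ 2) <= b].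
  move=> /andP[a0 _] /andP[b0 _] ab; rewrite ge_max le_min ge_min ab andbT /=.
  have -> : (Num.sqrt a <= b) = (a <= b ^+ 2).
    by rewrite -{2}(sqr_sqrtr a0) ler_sqr// nnegrE ?sqrtr_ge0.
  have -> : (1 - b <= a) = (1 - a <= b) by apply/idP/idP; lra.
  case: (leP (b ^+ 2) a) => [_|/ltW->]; last by rewrite !orbT.
  case: (leP (1 - a) b) => [//|/ltW h /=].
  case: (leP b (2 * a - a ^+ 2)) => [_|/ltW->]; last by rewrite !orbT.
  by rewrite h.
move=> hx hy; have /orP[xy|yx] := le_total x y.
  by have /or3P[->|->|->] := half _ _ hx hy xy; rewrite ?orbT.
by have /or3P[->|->|->] := half _ _ hy hx yx; rewrite ?orbT.
Qed.

End well_defined.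

(* Main.v *)
(* Put [f x = phi x - x] and [g x = 1 - x - psi (1 - x)]; in the coordinates
   [a = x], [b = 1 - y] the asymmetry at [x <= y] is
   [min (a b, f a * g b) - f (1 - b) * g (1 - a)]. Monotonicity of [f + id] and
   [g + id] bounds the values at [1 - b], [1 - a] from below by those at [a],
   [b] minus [d = 1 - a - b], and the ratio conditions bound them from above.
   Optimizing over the four values gives the bound [a d / (1 - b)] when
   [b <= a] and [(1 - b)^2 <= a], next to the trivial bound [a b]; exchanging
   [f] and [g] exchanges [a] and [b]. Both bounds are attained by trapezoidal
   profiles: [g + id] equal to [1] from [b] on, and [f + id] constant between
   [a] and [a / (1 - b)]. At [a = 4/9], [b = 1/3] this gives [4/27]. *)

Require Import Defs.
From mathcomp Require Import all_boot all_order all_algebra.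
From mathcomp Require Import all_classical all_reals all_analysis.
From mathcomp Require Import ring lra.

Import Order.TTheory GRing.Theory Num.Theory.
Import numFieldNormedType.Exports.

Local Open Scope classical_set_scope.
Local Open Scope ring_scope.

(* The class [F] of the paper; the condition that [h x / x] is nonincreasing
   is cleared of denominators. *)
Definition profile {R : realType} (h : R -> R) : Prop :=
  [/\ h 0 = 0, h 1 = 0,
      forall s t : R, 0 <= s -> s <= t -> t <= 1 -> h s + s <= h t + t &
      forall s t : R, 0 <= s -> s <= t -> t <= 1 -> h t * s <= h s * t].

Definition profile_copula {R : realType} (f g : R -> R) (x y : R) : R :=
  Num.min x (x * y + f x * g (1 - y)).

(* [C x y - C y x] for [C = profile_copula f g] and [x <= y], in the
   coordinates [a = x], [b = 1 - y], for which exchanging [f] and [g] amounts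
   to exchanging [a] and [b]. *)
Definition profile_asym {R : realType} (f g : R -> R) (a b : R) : R :=
  Num.min (a * b) (f a * g b) - f (1 - b) * g (1 - a).

(** For [0 < e <= c <= 1] and [t >= 0], adding [t] gives [max(t, min(t, e) / c)]: slope [1 / c] up
    to [e], then constant [e / c] until the diagonal is met. *)
Definition trapezoid {R : realType} (c e t : R) : R :=
  Num.max 0 (Num.min t e / c - t).

Definition is_profile_asym_max {R : realType} (a b v : R) : Prop :=
  (forall f g, profile f -> profile g -> `|profile_asym f g a b| <= v) /\
  (exists f g, [/\ profile f, profile g & v <= `|profile_asym f g a b|]).

Section Profiles.
Context {R : realType}.
Implicit Types (f g h : R -> R) (C : R -> R -> R) (a b c e v x y : R).

(** * Range of profiles, and the extremal ones *)

Lemma profile_ge0 h x : profile h -> 0 <= x <= 1 -> 0 <= h x.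
Proof.
move=> [_ h1 _ hr] /andP[x0 x1].
by have := hr x 1 x0 x1 (lexx _); rewrite h1 mul0r mulr1.
Qed.

Lemma profile_le h x : profile h -> 0 <= x <= 1 -> h x <= 1 - x.
Proof.
move=> [_ h1 hm _] /andP[x0 x1].
by have := hm x 1 x0 x1 (lexx _); rewrite h1; lra.
Qed.

Lemma profile_trapezoid c e : 0 < e -> e <= c -> c <= 1 ->
  profile (trapezoid c e).
Proof.
move=> e0 ec c1; have c0 : 0 < c by exact: lt_le_trans ec.
have ci0 : 0 < c^-1 by rewrite invr_gt0.
have ci1 : 1 <= c^-1 by rewrite invf_ge1.
have ecM : e / c <= 1 by rewrite ler_pdivrMr ?mul1r.
split.
- by rewrite /trapezoid min_l ?(ltW e0)// mul0r subr0 maxxx.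
- by rewrite /trapezoid min_r ?(le_trans ec)// max_l// subr_le0.
- move=> s t s0 st t1; rewrite /trapezoid !minr_pMl ?(ltW ci0)//.
  have sc : s <= s / c by rewrite ler_peMr.
  have tc : t <= t / c by rewrite ler_peMr ?(le_trans s0).
  have stc : s / c <= t / c by rewrite ler_pM2r.
  move: (s / c) (t / c) (e / c) sc tc stc ecM => S T E sc tc stc ecM.
  by case: (leP S) => ?; case: (leP T) => ?;
    case: (leP 0) => ?; case: (leP 0) => ?; lra.
- move=> s t s0 st t1; rewrite /trapezoid !maxr_pMl ?(le_trans s0)// !mul0r.
  rewrite le_max2// !mulrBl (mulrC t s) lerD2r mulrAC (mulrAC _ _ t).
  rewrite ler_pM2r// !minr_pMl ?(le_trans s0)// (mulrC t s) le_min2//.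
  by rewrite ler_pM2l.
Qed.

(** * Profiles as coordinates for maxmin copulas *)

(** This is the rectangle inequality of a copula after the substitution [t = 1 - y] of
    [profile_copulaE], which turns the outer minimum into [max 0]. The proof splits on the signs of
    the two terms on the left. *)
Lemma profile_copula_2increasing (x1 x2 t1 t2 f1 f2 g1 g2 : R) :
  0 <= x1 -> x1 <= x2 -> 0 <= t2 -> t2 <= t1 ->
  0 <= f1 -> 0 <= f2 -> 0 <= g1 -> 0 <= g2 ->
  f1 + x1 <= f2 + x2 -> f2 * x1 <= f1 * x2 ->
  g2 + t2 <= g1 + t1 -> g1 * t2 <= g2 * t1 ->
  Num.max 0 (x2 * t2 - f2 * g2) + Num.max 0 (x1 * t1 - f1 * g1) <=
  Num.max 0 (x2 * t1 - f2 * g1) + Num.max 0 (x1 * t2 - f1 * g2).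
Proof.
move=> x10 x12 t20 t21 f10 f20 g10 g20 fm fr gm gr.
have M21 : 0 <= Num.max 0 (x2 * t1 - f2 * g1) by rewrite le_max lexx.
have M12 : 0 <= Num.max 0 (x1 * t2 - f1 * g2) by rewrite le_max lexx.
have m21 : x2 * t1 - f2 * g1 <= Num.max 0 (x2 * t1 - f2 * g1).
  by rewrite le_max lexx orbT.
have m12 : x1 * t2 - f1 * g2 <= Num.max 0 (x1 * t2 - f1 * g2).
  by rewrite le_max lexx orbT.
have [m11|m11] := leP (x1 * t1 - f1 * g1) 0; rewrite ?add0r ?addr0.
  have [m22|m22] := leP (x2 * t2 - f2 * g2) 0; first lra.
  have t2p : 0 < t2.
    rewrite lt_neqAle t20 andbT; apply/eqP => t2E.
    by have := mulr_ge0 f20 g20; rewrite -t2E mulr0 in m22; lra.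
  (* By the ratio condition on [g], dividing the two sides by [t2] and [t1] leaves quotients in the
     same order; the left one is positive and [t2 <= t1]. *)
  suff : x2 * t2 - f2 * g2 <= x2 * t1 - f2 * g1 by lra.
  rewrite -(ler_pM2r t2p).
  have := mulr_ge0 f20 (_ : 0 <= g2 * t1 - g1 * t2).
  have := mulr_ge0 (ltW m22) (_ : 0 <= t1 - t2).
  by rewrite !subr_ge0 => /(_ t21) H1 /(_ gr) H2; lra.
have x1p : 0 < x1.
  rewrite lt_neqAle x10 andbT; apply/eqP => x1E.
  by have := mulr_ge0 f10 g10; rewrite -x1E mul0r in m11; lra.
have [m22|m22] := leP (x2 * t2 - f2 * g2) 0; rewrite ?add0r ?addr0.
  suff : x1 * t1 - f1 * g1 <= x2 * t1 - f2 * g1 by lra.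
  rewrite -(ler_pM2r x1p).
  have := mulr_ge0 g10 (_ : 0 <= f1 * x2 - f2 * x1).
  have := mulr_ge0 (ltW m11) (_ : 0 <= x2 - x1).
  by rewrite !subr_ge0 => /(_ x12) H1 /(_ fr) H2; lra.
have t2p : 0 < t2.
  rewrite lt_neqAle t20 andbT; apply/eqP => t2E.
  by have := mulr_ge0 f20 g20; rewrite -t2E mulr0 in m22; lra.
(* The first disjunct is the inequality with all maxima removed. It may fail only if [f] grows,
   [g2 < g1] and [x1 * t2 < f1 * g2]; then one term on the right already suffices. *)
suff H : - ((f2 - f1) * (g2 - g1)) <= (x2 - x1) * (t1 - t2) \/
    (x2 * t2 - f2 * g2) + (x1 * t1 - f1 * g1) <= x2 * t1 - f2 * g1.
  by case: H => ?; lra.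
have dx : 0 <= x2 - x1 by lra.
have dt : 0 <= t1 - t2 by lra.
have [u0|u0] := leP (f2 - f1) 0.
  left; have := mulr_ge0 (_ : 0 <= f1 - f2) (_ : 0 <= (t1 - t2) - (g2 - g1)).
  have := mulr_ge0 (_ : 0 <= (x2 - x1) + (f2 - f1)) dt.
  move=> H1 H2; have {}H1 := H1 ltac:(lra).
  by have {}H2 := H2 ltac:(lra) ltac:(lra); lra.
have [v0|v0] := leP 0 (g2 - g1).
  by left; have := mulr_ge0 (ltW u0) v0; have := mulr_ge0 dx dt; lra.
(* The relative increments of [f] and [g] are at most those of [x] and [t]; their product is
   combined with [f1 * g2 <= x1 * t2]. *)
have [m12'|m12'] := leP 0 (x1 * t2 - f1 * g2).
  left; rewrite -(ler_pM2r (mulr_gt0 x1p t2p)).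
  have H1 : (f2 - f1) * x1 <= f1 * (x2 - x1) by lra.
  have H2 : (g1 - g2) * t2 <= g2 * (t1 - t2) by lra.
  have H3 := ler_pM (_ : 0 <= (f2 - f1) * x1) (_ : 0 <= (g1 - g2) * t2) H1 H2.
  have {}H3 := H3 ltac:(by apply: mulr_ge0; lra) ltac:(by apply: mulr_ge0; lra).
  by have := mulr_ge0 (mulr_ge0 dx dt) m12'; lra.
right.
have g2p : 0 < g2.
  rewrite lt_neqAle g20 andbT; apply/eqP => g2E.
  by have := mulr_ge0 x10 t20; rewrite -g2E mulr0 in m12'; lra.
rewrite -(ler_pM2r g2p).
have H1 := mulr_ge0 (ltW m22) (_ : 0 <= g1 - g2).
have {}H1 := H1 ltac:(lra).
have H2 := mulr_ge0 g10 (_ : 0 <= f1 * g2 - x1 * t2).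
have {}H2 := H2 ltac:(lra).
have H3 := mulr_ge0 dx (_ : 0 <= g2 * t1 - g1 * t2).
have {}H3 := H3 ltac:(lra).
by lra.
Qed.

Lemma profile_copulaE f g x t :
  profile_copula f g x (1 - t) = x - Num.max 0 (x * t - f x * g t).
Proof.
rewrite /profile_copula; have -> : 1 - (1 - t) = t by ring.
by case: (leP 0); case: (leP x) => ? ?; lra.
Qed.

Lemma copula_profile f g : profile f -> profile g ->
  copula (profile_copula f g).
Proof.
move=> Pf Pg; have [f0 f1 fm fr] := Pf; have [g0 g1 gm gr] := Pg.
split.
- move=> x y /andP[x0 x1] /andP[y0 y1]; rewrite /profile_copula.
  have := profile_ge0 f x Pf ltac:(lra).
  have := profile_ge0 g (1 - y) Pg ltac:(lra).
  move=> gy fx; have := mulr_ge0 fx gy; have := mulr_ge0 x0 y0.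
  by case: (leP x) => ? ? ?; apply/andP; split; lra.
- move=> x /andP[x0 x1]; rewrite /profile_copula f0 subr0 g1.
  by rewrite !mulr0 !mul0r !addr0 minxx min_r.
- move=> x /andP[x0 x1]; rewrite /profile_copula f1 subrr g0.
  by rewrite mulr0 mul0r !addr0 mulr1 mul1r minxx min_r.
- move=> x1 x2 y1 y2 x10 x12 x21 y10 y12 y21.
  have yE y : y = 1 - (1 - y) by ring.
  rewrite (yE y1) (yE y2) !profile_copulaE.
  have := profile_copula_2increasing x1 x2 (1 - y1) (1 - y2)
    (f x1) (f x2) (g (1 - y1)) (g (1 - y2)) x10 x12 ltac:(lra) ltac:(lra)
    (profile_ge0 f x1 Pf ltac:(lra)) (profile_ge0 f x2 Pf ltac:(lra))
    (profile_ge0 g (1 - y1) Pg ltac:(lra))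
    (profile_ge0 g (1 - y2) Pg ltac:(lra))
    (fm x1 x2 x10 x12 x21) (fr x1 x2 x10 x12 x21)
    (gm (1 - y2) (1 - y1) ltac:(lra) ltac:(lra) ltac:(lra))
    (gr (1 - y2) (1 - y1) ltac:(lra) ltac:(lra) ltac:(lra)).
  by lra.
Qed.

Lemma maxmin_copula_profile f g : profile f -> profile g ->
  maxmin_copula (profile_copula f g).
Proof.
move=> Pf Pg; have [f0 f1 fm fr] := Pf; have [g0 g1 gm gr] := Pg.
split; first exact: copula_profile.
exists (fun x => x + f x), (fun y => y - g (1 - y)); split; last first.
  by move=> x y _ _; rewrite /profile_copula; congr Num.min; ring.
split.
- split; last 2 first.
  + by rewrite f0 addr0.
  + by rewrite f1 addr0.
  + move=> x hx; have := profile_ge0 f x Pf hx; have := profile_le f x Pf hx.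
    by move: hx => /andP[? ?] ? ?; lra.
  + by move=> x1 x2 h1 h2 h3; have := fm x1 x2 h1 h2 h3; lra.
- split; last 2 first.
  + by rewrite subr0 g1 subr0.
  + by rewrite subrr g0 subr0.
  + move=> x /andP[x0 x1].
    have := profile_ge0 g (1 - x) Pg ltac:(lra).
    by have := profile_le g (1 - x) Pg ltac:(lra); lra.
  + move=> x1 x2 h1 h2 h3.
    by have := gm (1 - x2) (1 - x1) ltac:(lra) ltac:(lra) ltac:(lra); lra.
- move=> x1 x2 x10 x12 x21; rewrite /phi_star.
  rewrite ler_pdivrMr ?(lt_le_trans x10)// mulrAC ler_pdivlMr//.
  by have := fr x1 x2 (ltW x10) x12 x21; lra.
(* Where [g (1 - x)] is nonzero, the quotient is [1 + (1 - x) / g (1 - x)], so its monotonicity is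
   the ratio condition on [g]. *)
- move=> x1 x2 x10 x12 x21; rewrite /psi_star.
  have [x1E|x1N] := eqVneq x1 1.
    by rewrite (_ : x2 = 1) ?eqxx//; lra.
  have x1lt : x1 < 1 by rewrite lt_neqAle x1N (le_trans x12).
  have [_|psi1] := eqVneq (x1 - g (1 - x1)) x1; first by rewrite leey.
  have h1 := profile_ge0 g (1 - x1) Pg ltac:(lra).
  have {psi1} g1p : 0 < g (1 - x1).
    rewrite lt_neqAle h1 andbT; apply/eqP => E.
    by move/eqP: psi1; rewrite -E; lra.
  have [_|x2N] := eqVneq x2 1.
    by rewrite lee_fin ler_pdivlMr; lra.
  have x2lt : x2 < 1 by rewrite lt_neqAle x2N.
  have h2 := profile_ge0 g (1 - x2) Pg ltac:(lra).
  have r := gr (1 - x2) (1 - x1) ltac:(lra) ltac:(lra) ltac:(lra).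
  have g2p : 0 < g (1 - x2).
    rewrite lt_neqAle h2 andbT; apply/eqP => E; move: r; rewrite -E mul0r.
    by have := mulr_gt0 g1p (_ : 0 < 1 - x2); rewrite subr_gt0 => /(_ x2lt); lra.
  rewrite ifF; last by apply/negbTE/eqP; lra.
  rewrite lee_fin ler_pdivrMr; last lra.
  by rewrite mulrAC ler_pdivlMr; lra.
Qed.

Lemma maxmin_copula_has_profile C : maxmin_copula C ->
  exists f g, [/\ profile f, profile g &
    forall x y, 0 <= x <= 1 -> 0 <= y <= 1 -> C x y = profile_copula f g x y].
Proof.
move=> [_ [phi [psi [[gphi gpsi hphi hpsi] CE]]]].
have [phi01 phim phi0 phi1] := gphi; have [psi01 psim psi0 psi1] := gpsi.
exists (fun x => phi x - x), (fun x => 1 - x - psi (1 - x)).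
split.
- split.
  + by rewrite phi0 subr0.
  + by rewrite phi1 subrr.
  + by move=> s t s0 st t1; have := phim s t s0 st t1; lra.
  + move=> s t s0 st t1; have [->|sN] := eqVneq s 0.
      by rewrite phi0 mulr0 subrr mul0r.
    have sp : 0 < s by rewrite lt_neqAle eq_sym sN.
    have tp : 0 < t by exact: lt_le_trans st.
    have := hphi s t sp st t1; rewrite /phi_star.
    by rewrite ler_pdivrMr// mulrAC ler_pdivlMr//; lra.
(* The convention [psi_star psi 1 = 1] keeps [psi_star] at least [1], whereas [psi x > x] would make
   the quotient nonpositive. *)
- have g0 x : 0 <= x <= 1 -> psi x <= x.
    move=> /andP[x0 x1]; have [->|xN] := eqVneq x 1; first by rewrite psi1.
    have xlt : x < 1 by rewrite lt_neqAle xN.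
    have := hpsi x 1 x0 x1 (lexx _); rewrite /psi_star eqxx (negbTE xN).
    have [->//|psiN] := eqVneq (psi x) x.
    rewrite lee_fin; have [//|xpsi] := leP (psi x) x.
    have /andP[_ p1] := psi01 x ltac:(lra).
    have : (1 - psi x) / (x - psi x) <= 0.
      by rewrite mulr_ge0_le0 ?invr_le0; lra.
    by lra.
  split.
  + by rewrite subr0 psi1 subrr.
  + by rewrite subrr psi0 subrr.
  + move=> s t s0 st t1.
    by have := psim (1 - t) (1 - s) ltac:(lra) ltac:(lra) ltac:(lra); lra.
  + move=> s t s0 st t1; have [->|sN] := eqVneq s 0.
      by rewrite mulr0 subr0 psi1 subrr mul0r.
    have sp : 0 < s by rewrite lt_neqAle eq_sym sN.
    have ht := g0 (1 - t) ltac:(lra); have hs := g0 (1 - s) ltac:(lra).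
    have := hpsi (1 - t) (1 - s) ltac:(lra) ltac:(lra) ltac:(lra).
    rewrite /psi_star.
    have -> : (1 - t == 1) = false by apply/negbTE/eqP; lra.
    have -> : (1 - s == 1) = false by apply/negbTE/eqP; lra.
    have [->|ptN] := eqVneq (psi (1 - t)) (1 - t).
      by rewrite subrr mul0r => _; apply: mulr_ge0; lra.
    have [//|psN] := eqVneq (psi (1 - s)) (1 - s).
    have ptlt : psi (1 - t) < 1 - t by rewrite lt_neqAle ptN.
    have pslt : psi (1 - s) < 1 - s by rewrite lt_neqAle psN.
    rewrite lee_fin ler_pdivrMr; last lra.
    by rewrite mulrAC ler_pdivlMr; lra.
- move=> x y hx hy; rewrite CE// /profile_copula.
  have -> : 1 - (1 - y) = y by ring.
  by congr Num.min; ring.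
Qed.

(** * Sharp bounds on the asymmetry of a pair of profiles *)

Lemma profile_asymC f g a b : profile_asym g f b a = profile_asym f g a b.
Proof.
by rewrite /profile_asym (mulrC b) (mulrC (g b)) (mulrC (g (1 - a))).
Qed.

Lemma profile_asymE f g x y : profile f -> profile g ->
  0 <= x -> x <= y -> y <= 1 ->
  profile_copula f g x y - profile_copula f g y x = profile_asym f g x (1 - y).
Proof.
move=> Pf Pg x0 xy y1; rewrite /profile_copula /profile_asym.
have -> : 1 - (1 - y) = y by ring.
(* Hence [x * y + f y * g (1 - x) <= x <= y], which resolves the minimum in
   [profile_copula f g y x]. *)
have H : f y * g (1 - x) <= (1 - y) * x.
  apply: ler_pM; first by apply: profile_ge0 => //; lra.
  - by apply: profile_ge0 => //; lra.
  - by apply: profile_le => //; lra.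
  - by have := profile_le g (1 - x) Pg ltac:(lra); lra.
rewrite (@min_r _ _ y); last lra.
by case: (leP x); case: (leP (x * (1 - y))) => ? ?; lra.
Qed.

(** Both terms of the difference lie between [0] and [a * b]. *)
Lemma profile_asym_le_mul f g a b : profile f -> profile g ->
  0 <= a -> 0 <= b -> a + b <= 1 -> `|profile_asym f g a b| <= a * b.
Proof.
move=> Pf Pg a0 b0 ab; rewrite /profile_asym ler_norml.
have H : f (1 - b) * g (1 - a) <= b * a.
  apply: ler_pM; first by apply: profile_ge0 => //; lra.
  - by apply: profile_ge0 => //; lra.
  - by have := profile_le f (1 - b) Pf ltac:(lra); lra.
  - by have := profile_le g (1 - a) Pg ltac:(lra); lra.
have := mulr_ge0 (profile_ge0 f (1 - b) Pf ltac:(lra))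
  (profile_ge0 g (1 - a) Pg ltac:(lra)).
have := mulr_ge0 (profile_ge0 f a Pf ltac:(lra))
  (profile_ge0 g b Pg ltac:(lra)).
by have := mulr_ge0 a0 b0; case: (leP (a * b)) => *; apply/andP; split; lra.
Qed.

Lemma profile_asym_le f g a b : profile f -> profile g ->
  0 <= b -> b <= a -> a + b <= 1 -> (1 - b) ^+ 2 <= a ->
  `|profile_asym f g a b| <= a / (1 - b) * (1 - a - b).
Proof.
move=> Pf Pg b0 ba ab; rewrite expr2 => Qa.
have [aE|aN] := eqVneq a 1.
  have bE : b = 0 by lra.
  apply: le_trans (profile_asym_le_mul f g a b Pf Pg _ _ _) _; try lra.
  by rewrite aE bE; lra.
have a1 : 0 < 1 - a by rewrite subr_gt0 lt_neqAle aN; lra.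
have Q0 : 0 < 1 - b by lra.
rewrite mulrAC ler_pdivlMr// -[X in _ * X]gtr0_norm// -normrM ler_norml.
have [_ _ fm fr] := Pf; have [_ _ gm gr] := Pg.
have {}fm := fm a (1 - b) ltac:(lra) ltac:(lra) ltac:(lra).
have {}fr := fr a (1 - b) ltac:(lra) ltac:(lra) ltac:(lra).
have {}gm := gm b (1 - a) ltac:(lra) ltac:(lra) ltac:(lra).
have {}gr := gr b (1 - a) ltac:(lra) ltac:(lra) ltac:(lra).
have p0 := profile_ge0 f a Pf ltac:(lra).
have p'0 := profile_ge0 f (1 - b) Pf ltac:(lra).
have q0 := profile_ge0 g b Pg ltac:(lra).
have q'0 := profile_ge0 g (1 - a) Pg ltac:(lra).
have p1 := profile_le f a Pf ltac:(lra).
have p'1 := profile_le f (1 - b) Pf ltac:(lra).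
have q1 := profile_le g b Pg ltac:(lra).
have q'1 := profile_le g (1 - a) Pg ltac:(lra).
rewrite /profile_asym.
move: (f a) (f (1 - b)) (g b) (g (1 - a)) fm fr gm gr p0 p'0 q0 q'0 p1 p'1 q1
  q'1 => p p' q q' fm fr gm gr p0 p'0 q0 q'0 p1 p'1 q1 q'1.
have p'q'_le : p' * q' <= b * a by apply: ler_pM; lra.
have ad0 : 0 <= a * (1 - a - b) by apply: mulr_ge0; lra.
apply/andP; split.
  case: (leP (a * b)) => [_|_].
    suff : 0 <= (a * b - p' * q') * (1 - b) by lra.
    by apply: mulr_ge0; lra.
  (* The ratio conditions control the negative side: with [d = 1 - a - b], they give [(p' * q' - p *
     q) * (1 - a) * (1 - b) <= p' * q' * d <= a * b * d], and [b <= 1 - a]. *)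
  have H : (p' * a) * (q' * b) <= (p * (1 - b)) * (q * (1 - a)).
    by apply: ler_pM => //; apply: mulr_ge0; lra.
  rewrite -(ler_pM2r a1).
  have H1 : 0 <= (b * a - p' * q') * (1 - a - b) by apply: mulr_ge0; lra.
  have H2 : 0 <= a * (1 - a - b) * (1 - a - b) by apply: mulr_ge0; lra.
  by lra.
set d := 1 - a - b in ad0 *; have dE : d = 1 - a - b by [].
have d0 : 0 <= d by lra.
have p'q'0 := mulr_ge0 p'0 q'0.
have mab : Num.min (a * b) (p * q) <= a * b by rewrite ge_min lexx.
have mpq : Num.min (a * b) (p * q) <= p * q by rewrite ge_min lexx orbT.
move: (Num.min _ _) mab mpq => m mab mpq.
have Qad : 0 <= (a - (1 - b) * (1 - b)) * d by apply: mulr_ge0; lra.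
(* On the positive side, monotonicity gives [p' >= p - d] and [q' >= q - d], which is informative
   only when [p] and [q] exceed [d]. Otherwise [m <= d * (1 - b)], and [(1 - b)^2 <= a]
   concludes. *)
have small s t : 0 <= s -> 0 <= t -> s <= d -> t <= 1 - b -> m <= s * t ->
    (m - p' * q') * (1 - b) <= a * d.
  move=> s0 t0 sd t1 mst.
  have H1 : s * t <= d * (1 - b) by apply: ler_pM.
  have H2 : 0 <= (d * (1 - b) - (m - p' * q')) * (1 - b).
    by apply: mulr_ge0; lra.
  by lra.
have [pd|pd] := leP p d; first exact: (small p q).
have [qd|qd] := leP q d; first by apply: (small q p) => //; lra.
have H1 : (p - d) * (q - d) <= p' * q' by apply: ler_pM; lra.
have H2 : 0 <= (p' * q' - (p - d) * (q - d)) * (1 - b) by apply: mulr_ge0; lra.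
(* As [p <= 1 - a <= 1 - b] and [q <= 1 - b]. *)
have H3 : 0 <= (1 - b - p) * (1 - b - q) * d.
  by apply: mulr_ge0 => //; apply: mulr_ge0; lra.
have H4 : 0 <= (p * q - m) * a by apply: mulr_ge0; lra.
have H5 : 0 <= (a * b - m) * d by apply: mulr_ge0; lra.
(* The bounds [m <= p * q] and [m <= a * b] get weights [a] and [d], whose sum is [1 - b]; this
   cancels [m] and [p * q]. *)
suff : a * d - (m - p' * q') * (1 - b) = (p' * q' - (p - d) * (q - d)) * (1 - b)
  + (1 - b - p) * (1 - b - q) * d + (p * q - m) * a + (a * b - m) * d by lra.
by rewrite dE; ring.
Qed.

(** The parameter [1 - b] makes [f a * g b] equal to [a * b], so the minimum in [profile_asym] is a
    tie. With [r = a / (1 - b)], the subtracted term is [a * max(0, r - (1 - b))], which leaves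
    [a * min(b, 1 - r)]. *)
Lemma profile_asym_trapezoid a b : 0 < a -> 0 < b -> a + b <= 1 ->
  profile_asym (trapezoid (1 - b) a) (trapezoid b b) a b =
  Num.min (a * b) (a / (1 - b) * (1 - a - b)).
Proof.
move=> a0 b0 ab; have Q0 : 0 < 1 - b by lra.
have raE : a / (1 - b) * (1 - b) = a by rewrite divfK// gt_eqF.
rewrite /profile_asym /trapezoid !minxx divff ?gt_eqF//.
rewrite (@min_r _ _ (1 - b)); last lra.
rewrite (@min_r _ _ (1 - a)); last lra.
rewrite divff ?gt_eqF//.
have ar : a <= a / (1 - b).
  by rewrite ler_pdivlMr//; have := mulr_gt0 a0 b0; lra.
rewrite (@max_r _ _ 0 (a / (1 - b) - a)) ?subr_ge0//.
rewrite (@max_r _ _ 0 (1 - b)) ?(ltW Q0)//.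
rewrite (@max_r _ _ 0 (1 - (1 - a))); last lra.
move: (a / (1 - b)) raE ar => r raE ar.
have -> : (r - a) * (1 - b) = a * b by rewrite mulrBl raE; ring.
have -> : r * (1 - a - b) = a * (1 - r).
  have -> : r * (1 - a - b) = r * (1 - b) - a * r by ring.
  by rewrite raE; ring.
rewrite minxx -minr_pMr ?(ltW a0)//.
have -> : 1 - (1 - a) = a by ring.
rewrite (mulrC _ a) -mulrBr; congr (_ * _).
by case: (leP 0 (r - _)) => ?; case: (leP b) => ?; lra.
Qed.

Lemma profile_asym_ge a b : 0 <= a -> 0 <= b -> a + b <= 1 ->
  exists f g, [/\ profile f, profile g &
    Num.min (a * b) (a / (1 - b) * (1 - a - b)) <= `|profile_asym f g a b|].
Proof.
move=> a0 b0 ab; have [abE|abN] := eqVneq (a * b) 0.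
  have P0 : profile (fun=> 0 : R) by split => // *; lra.
  by exists (fun=> 0), (fun=> 0); split => //; rewrite abE ge_min normr_ge0.
move: abN; rewrite mulf_eq0 negb_or => /andP[aN bN].
have {aN}a0 : 0 < a by rewrite lt_neqAle eq_sym aN.
have {bN}b0 : 0 < b by rewrite lt_neqAle eq_sym bN.
exists (trapezoid (1 - b) a), (trapezoid b b); split.
- by apply: profile_trapezoid; lra.
- by apply: profile_trapezoid; lra.
- by rewrite profile_asym_trapezoid// ler_norm.
Qed.

Lemma profile_asym_maxC a b v :
  is_profile_asym_max a b v -> is_profile_asym_max b a v.
Proof.
move=> [ub [f [g [Pf Pg h]]]]; split.
  by move=> f' g' Pf' Pg'; rewrite profile_asymC; exact: ub.
by exists g, f; split => //; rewrite profile_asymC.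
Qed.

Lemma profile_asym_max_div a b : 0 <= b -> b <= a -> a + b <= 1 ->
  (1 - b) ^+ 2 <= a -> is_profile_asym_max a b (a / (1 - b) * (1 - a - b)).
Proof.
move=> b0 ba ab Qa; split; first by move=> f g Pf Pg; exact: profile_asym_le.
have [f [g [Pf Pg]]] := profile_asym_ge a b ltac:(lra) b0 ab.
rewrite min_r; first by move=> ?; exists f, g.
have Q0 : 0 < 1 - b by lra.
rewrite mulrAC ler_pdivrMr//.
have : 0 <= a * (a - (1 - b) ^+ 2) by apply: mulr_ge0; lra.
by rewrite expr2; lra.
Qed.

Lemma profile_asym_max_mul a b : 0 <= a -> 0 <= b -> a + b <= 1 ->
  a <= (1 - b) ^+ 2 -> is_profile_asym_max a b (a * b).
Proof.
move=> a0 b0 ab Qa; split.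
  by move=> f g Pf Pg; exact: profile_asym_le_mul.
have [f [g [Pf Pg]]] := profile_asym_ge a b a0 b0 ab.
have [bE|bN] := eqVneq b 1.
  have aE : a = 0 by lra.
  by move=> _; exists f, g; split => //; rewrite aE mul0r.
rewrite min_l; first by move=> ?; exists f, g.
have Q0 : 0 < 1 - b by rewrite subr_gt0 lt_neqAle bN; lra.
rewrite mulrAC ler_pdivlMr//.
have : 0 <= a * ((1 - b) ^+ 2 - a) by apply: mulr_ge0; lra.
by rewrite expr2; lra.
Qed.

(** * The constant 4/27 *)

(** The difference of the two sides is [(c - 2/3)^2 * (c + 1/3)]. *)
Lemma sqr_mul_onem_le c : 0 <= c -> c * c * (1 - c) <= 4 / 27.
Proof.
move=> c0; have := mulr_ge0 (sqr_ge0 (c - 2 / 3)) (_ : 0 <= c + 1 / 3).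
by rewrite expr2 => /(_ ltac:(lra)); lra.
Qed.

(** Each bound is at most [c * c * (1 - c)]: with [c = a / (1 - b)] for the quotient bound, and with
    [c = 1 - b] for the bound [a * b]. *)
Lemma profile_asym_le_4_27 f g a b : profile f -> profile g ->
  0 <= a -> 0 <= b -> a + b <= 1 -> `|profile_asym f g a b| <= 4 / 27.
Proof.
wlog ba : f g a b / b <= a.
  move=> H Pf Pg a0 b0 ab; have [/H|/ltW/H] := leP b a; first exact.
  by rewrite -profile_asymC; apply => //; lra.
move=> Pf Pg a0 b0 ab; have Q0 : 0 < 1 - b by lra.
have [Qa|/ltW Qa] := leP ((1 - b) ^+ 2) a.
  apply: le_trans (profile_asym_le f g a b Pf Pg b0 ba ab Qa) _.
  have rE : a / (1 - b) * (1 - b) = a by rewrite divfK// gt_eqF.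
  have r0 : 0 <= a / (1 - b) by rewrite divr_ge0// ltW.
  have Qr : 1 - b <= a / (1 - b) by rewrite ler_pdivlMr// -expr2.
  have r1 : a / (1 - b) <= 1 by rewrite ler_pdivrMr//; lra.
  apply: le_trans (sqr_mul_onem_le _ r0).
  move: (a / (1 - b)) rE r0 Qr r1 => r rE r0 Qr r1.
  rewrite -mulrA ler_wpM2l// -[X in 1 - X - b]rE.
  have : 0 <= (r - (1 - b)) * (1 - r) by apply: mulr_ge0; lra.
  by lra.
apply: le_trans (profile_asym_le_mul f g a b Pf Pg a0 b0 ab) _.
have := sqr_mul_onem_le (1 - b) (ltW Q0).
have : 0 <= ((1 - b) ^+ 2 - a) * b by apply: mulr_ge0; lra.
by rewrite expr2; lra.
Qed.

(** * From profiles back to suprema over copulas *)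

Lemma max_asymmetryC x y : max_asymmetry x y = max_asymmetry y x.
Proof.
rewrite /max_asymmetry; congr sup; apply/seteqP.
by split => _ [C MC <-]; exists C => //; rewrite distrC.
Qed.

Lemma maxmin_copula_asym C : maxmin_copula C -> exists f g,
  [/\ profile f, profile g & forall x y, 0 <= x -> x <= y -> y <= 1 ->
    C x y - C y x = profile_asym f g x (1 - y)].
Proof.
move=> /maxmin_copula_has_profile[f [g [Pf Pg CE]]]; exists f, g; split => //.
move=> x y x0 xy y1; have x01 : 0 <= x <= 1 by rewrite x0 (le_trans xy).
have y01 : 0 <= y <= 1 by rewrite y1 (le_trans x0).
by rewrite !CE// profile_asymE.
Qed.

Lemma max_asymmetryE x y v : 0 <= x -> x <= y -> y <= 1 ->
  is_profile_asym_max x (1 - y) v -> max_asymmetry x y = v.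
Proof.
move=> x0 xy y1 [ub [f [g [Pf Pg vle]]]].
have x01 : 0 <= x <= 1 by rewrite x0 (le_trans xy).
have y01 : 0 <= y <= 1 by rewrite y1 (le_trans x0).
have supA := has_sup_max_asymmetry x01 y01; apply/eqP; rewrite eq_le.
apply/andP; split.
  apply: ge_sup; first exact: supA.1.
  move=> _ [C /maxmin_copula_asym[f' [g' [Pf' Pg' CE]]] <-].
  by rewrite CE//; exact: ub.
apply: le_trans vle _; rewrite -profile_asymE//.
apply: ub_le_sup; first exact: supA.2.
by exists (profile_copula f g) => //; exact: maxmin_copula_profile.
Qed.

(** With [a = x] and [b = 1 - y], the first case is the quotient bound, the second is the same with
    [a] and [b] exchanged, and the third is the product bound. *)
Lemma max_asymmetry_formula x y : 0 <= x <= 1 -> 0 <= y <= 1 ->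
  [/\ Num.max (1 - y) (y ^+ 2) <= x <= y ->
        max_asymmetry x y = x / y * (y - x),
      x <= y <= Num.min (2 * x - x ^+ 2) (1 - x) ->
        max_asymmetry x y = (1 - y) / (1 - x) * (y - x) &
      Num.min (Num.sqrt x) (2 * x - x ^+ 2) <= y ->
        max_asymmetry x y = x * (1 - y)].
Proof.
move=> /andP[x0 x1] /andP[y0 y1].
have yE : 1 - (1 - y) = y by ring.
have xx : 0 <= x * (1 - x) by apply: mulr_ge0; lra.
split.
- rewrite ge_max => /andP[/andP[yx y2x] xy]; apply: max_asymmetryE => //.
  have -> : y - x = 1 - x - (1 - y) by ring.
  by rewrite -[X in _ / X]yE; apply: profile_asym_max_div; rewrite ?yE//; lra.
- rewrite le_min => /and3P[xy yx2 yx]; apply: max_asymmetryE => //.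
  apply: profile_asym_maxC.
  have -> : y - x = 1 - (1 - y) - x by ring.
  by apply: profile_asym_max_div => //; lra.
(* The alternatives read [a <= (1 - b)^2] and [b <= (1 - a)^2]; each implies [x <= y]. *)
- rewrite ge_min => /orP[sxy|xy2].
    have xy2 : x <= y ^+ 2.
      by rewrite -[leLHS]sqr_sqrtr// ler_sqr ?nnegrE ?sqrtr_ge0.
    have yy : 0 <= y * (1 - y) by apply: mulr_ge0; lra.
    have xy : x <= y by move: xy2; rewrite expr2; lra.
    by apply: max_asymmetryE => //; apply: profile_asym_max_mul; rewrite ?yE//; lra.
  have xy : x <= y by move: xy2; rewrite expr2; lra.
  apply: max_asymmetryE => //; apply: profile_asym_maxC; rewrite mulrC.
  by apply: profile_asym_max_mul; lra.
Qed.

Lemma mu_infty_le_4_27 C : maxmin_copula C -> mu_infty C <= 4 / 27.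
Proof.
move=> MC; have [f [g [Pf Pg CE]]] := maxmin_copula_asym C MC.
have [x [y [/andP[x0 x1] /andP[y0 y1] -> _]]] := mu_infty_max MC.1.
have [xy|/ltW yx] := leP x y.
  by rewrite CE//; apply: profile_asym_le_4_27 => //; lra.
by rewrite distrC CE//; apply: profile_asym_le_4_27 => //; lra.
Qed.

Lemma mu_infty_4_27 : exists C, maxmin_copula C /\ mu_infty C = 4 / 27.
Proof.
(* Here [1 - b] is the maximizer [2/3] of [c * c * (1 - c)], and [a = (1 - b)^2] is where the two
   bounds agree. *)
pose a : R := 4 / 9; pose b : R := 1 / 3.
have [_ [f [g [Pf Pg]]]] : is_profile_asym_max a b (a * b).
  by apply: profile_asym_max_mul; rewrite /a /b ?expr2; lra.
have MC := maxmin_copula_profile f g Pf Pg.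
have -> : b = 1 - 2 / 3 by rewrite /b; lra.
rewrite -profile_asymE//; try by rewrite /a; lra.
move=> le_ab; exists (profile_copula f g); split => //.
apply/eqP; rewrite eq_le mu_infty_le_4_27//=.
have [x [y [_ _ -> max]]] := mu_infty_max MC.1.
apply: le_trans (max a (2 / 3) _ _); rewrite /a; try lra.
by move: le_ab; rewrite /a; lra.
Qed.

End Profiles.

Theorem theorem5p6 (R : realType) :
  (forall C : R -> R -> R, maxmin_copula C -> mu_infty C <= 4 / 27) /\
  (exists C : R -> R -> R, maxmin_copula C /\ mu_infty C = 4 / 27) /\
  sup [set mu_infty C | C in @maxmin_copula R] = 4 / 27 /\
  (forall x y : R, 0 <= x <= 1 -> 0 <= y <= 1 ->
    (Num.max (1 - y) (y ^+ 2) <= x <= y ->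
       max_asymmetry x y = x / y * (y - x)) /\
    (x <= y <= Num.min (2 * x - x ^+ 2) (1 - x) ->
       max_asymmetry x y = (1 - y) / (1 - x) * (y - x)) /\
    (Num.min (Num.sqrt x) (2 * x - x ^+ 2) <= y ->
       max_asymmetry x y = x * (1 - y)) /\
    (Num.min (Num.sqrt y) (2 * y - y ^+ 2) <= x ->
       max_asymmetry x y = y * (1 - x)) /\
    (Num.max (1 - x) (x ^+ 2) <= y <= x ->
       max_asymmetry x y = y / x * (x - y)) /\
    (y <= x <= Num.min (2 * y - y ^+ 2) (1 - y) ->
       max_asymmetry x y = (1 - x) / (1 - y) * (x - y))).
Proof.
split; first exact: mu_infty_le_4_27.
split; first exact: mu_infty_4_27.
split.
  apply/eqP; rewrite eq_le; apply/andP; split.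
    apply: ge_sup; first exact: (has_sup_mu_infty R).1.
    by move=> _ [C MC <-]; exact: mu_infty_le_4_27.
  have [C [MC <-]] := @mu_infty_4_27 R.
  by apply: ub_le_sup; [exact: (has_sup_mu_infty R).2 | exists C].
move=> x y hx hy.
have [h1 h2 h3] := max_asymmetry_formula x y hx hy.
have [h4 h5 h6] := max_asymmetry_formula y x hy hx.
(* The last three cases are the first three with [x] and [y] exchanged. *)
do 3! [split => //]; rewrite max_asymmetryC.
by do ! split.
Qed.
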